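(* For any $n\ge 6$ there is a perfect code in the Star graph $S_n$ which is not isomorphic to $\mathrm{Stab}_1(\mathrm{Sym}_n)$.
   Context: $\mathrm{Sym}_n$ is the symmetric group on $\{1,\ldots,n\}$ and $\mathrm{Stab}_1(\mathrm{Sym}_n)=\{\pi\in\mathrm{Sym}_n:\pi(1)=1\}$. For a group $G$ with an inverse-closed generating set $H$ not containing the identity, the Cayley graph $\Gamma(G,H)$ has vertex set $G$ and edge set $\{(hg,g): g\in G,\ h\in H\}$. The Star graph is $S_n=\Gamma(\mathrm{Sym}_n,\{(1\ i):2\le i\le n\})$; it is $(n-1)$-regular. A code in a graph is a subset $C$ of its vertices; its minimum distance is $\min_{x,y\in C,\,x\ne y}d(x,y)$, where $d$ is the graph distance. A code $C$ in a $k$-regular graph with vertex set $V$ is perfect if its minimum distance is $3$ and $|C|=|V|/(k+1)$. Two codes in a graph $\Gamma$ are isomorphic if there is an automorphism of the graph $\Gamma$ mapping one code onto the other. *)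

(* Defs.v *)
From mathcomp Require Import all_boot all_fingroup.

Set Implicit Arguments.
Unset Strict Implicit.
Unset Printing Implicit Defensive.

Import GroupScope.

(* A finite graph is a finType T with an adjacency relation e : rel T. *)
Section Graphs.
Variables (T : finType) (e : rel T).

Definition regular_graph (k : nat) : Prop :=
  forall x : T, #|[set y | e x y]| = k.

(* Relational, so that vertices in different components are at no
   (i.e. infinite) distance. *)
Definition graph_dist (x y : T) (d : nat) : Prop :=
  (exists p : seq T, [/\ path e x p, last x p = y & size p = d]) /\
  (forall p : seq T, path e x p -> last x p = y -> d <= size p).

(* A code with at most one vertex has no minimum distance. *)
Definition min_distance (C : {set T}) (d : nat) : Prop :=
  (exists x y : T, [/\ x \in C, y \in C, x != y & graph_dist x y d]) /\
  (forall (x y : T) (d' : nat),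
      x \in C -> y \in C -> x != y -> graph_dist x y d' -> d <= d').

(* The size condition is #|C| = #|T| / (k + 1) as rational numbers. *)
Definition perfect_code (C : {set T}) : Prop :=
  exists k : nat,
    [/\ regular_graph k, min_distance C 3 & (#|C| * k.+1)%N = #|T|].

Definition graph_automorphism (f : {perm T}) : Prop :=
  forall x y : T, e (f x) (f y) = e x y.

Definition isomorphic_codes (C D : {set T}) : Prop :=
  exists2 f : {perm T}, graph_automorphism f & f @: C = D.

End Graphs.

Definition cayley_graph (gT : finGroupType) (H : {set gT}) : rel gT :=
  fun x y => [exists h in H, x == h * y].

(* The points 1, ..., n are encoded as 0, ..., n - 1 in 'I_n, so that the
   distinguished point 1 is the ordinal of value 0.  The product of 'S_n is
   (s * t) x = t (s x); the other convention gives a graph isomorphic to this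
   one through s |-> s^-1, which fixes stab1 n. *)
Definition star_set (n : nat) : {set 'S_n} :=
  [set tperm i j | i in [set i : 'I_n | i == 0 :> nat],
                   j in [set j : 'I_n | j != 0 :> nat]].

Definition star_graph (n : nat) : rel 'S_n := cayley_graph (star_set n).
Arguments star_graph n : clear implicits.

Definition stab1 (n : nat) : {set 'S_n} :=
  [set s : 'S_n | [forall i : 'I_n, (i == 0 :> nat) ==> (s i == i)]].

Lemma star_setE n : star_set n.+1 = [set tperm ord0 i | i in [set~ ord0]].
Proof.
apply/setP=> s; apply/imset2P/imsetP.
  case=> i j; rewrite !inE => i0 j0 ->; exists j; rewrite ?inE //.
  by congr (tperm _ j); apply/val_inj/eqP.
by case=> j; rewrite !inE => j0 ->; exists ord0 j; rewrite ?inE.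
Qed.

Lemma stab1E n : stab1 n.+1 = 'C[ord0 | 'P].
Proof.
apply/setP=> s; rewrite inE; apply/forallP/astab1P=> [s1|s1 i] /=.
  exact/eqP/(s1 ord0).
apply/implyP=> i0; suff -> : i = ord0 by apply/eqP.
exact/val_inj/eqP.
Qed.

Lemma star_set1 n : 1 \notin star_set n.
Proof.
apply/imset2P=> -[i j]; rewrite !inE => /eqP i0 j0 /permP/(_ i).
by rewrite perm1 tpermL => ij; rewrite -ij i0 in j0.
Qed.

Lemma star_setV n s : s \in star_set n -> s^-1 \in star_set n.
Proof. by case/imset2P=> i j iP jP ->; rewrite tpermV; apply: imset2_f. Qed.

Lemma star_set_gen n : <<star_set n>> = [set: 'S_n].
Proof.
apply/eqP; rewrite eqEsubset subsetT; apply/subsetP=> s _.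
case: n s => [|n] s.
  suff -> : s = 1 by exact: group1.
  by apply/permP; case.
have starP j : tperm ord0 j \in <<star_set n.+1>>.
  have [->|j0] := eqVneq j ord0; first by rewrite tperm1 group1.
  by apply: mem_gen; rewrite star_setE imset_f // !inE.
have [ts -> _] := prod_tpermP s; apply: group_prod => -[i j] _ /=.
have [->|i0] := eqVneq i ord0; first exact: starP.
have [->|j0] := eqVneq j ord0; first by rewrite tpermC; exact: starP.
have [<-|ij] := eqVneq i j; first by rewrite tperm1 group1.
have -> : tperm i j = tperm ord0 j ^ tperm ord0 i.
  by rewrite tpermJ tpermL tpermD // eq_sym // eq_sym.
by rewrite groupJ.
Qed.

(* Main.v *)
Require Import Defs.
From mathcomp Require Import all_boot all_fingroup.

(* Left multiplication by [tperm o i] swaps the values of a permutation at [o]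
   and [i].  A code is perfect iff every permutation is brought into it by
   exactly one swap of [o] with some [i], the trivial swap [i = o] included.
   On six points PGL(2,5) is such a code: its nontrivial elements move at least
   four points, hence it contains no quotient of two swaps, and it has index 6.
   A code on the permutations of [A] lifts to [m |: A] by deleting [m] from its
   cycle, provided that [o] is not mapped to [m].
   The lift keeps [1] and a 4-cycle through [o]; these codewords are at distance
   3 and are joined by a single path of length 3, which never happens in [stab1]. *)

Set Implicit Arguments.
Unset Strict Implicit.
Unset Printing Implicit Defensive.

Import GroupScope.

(** * Tilings by swaps, and their lift to one more point *)

Definition star_tiling (T : finType) (o : T) (A : {set T}) (C : {set {perm T}}) :=
  forall x, perm_on A x -> #|[set i in A | tperm o i * x \in C]| = 1%N.

(** With [r] the preimage of [m], this moves the bypass of [m] past the swap with [i], which becomes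
    the swap with [tperm r m i]. *)
Lemma tperm_mul_conj (T : finType) (o i m r : T) : o != m -> i != r ->
  tperm (tperm o i r) m * tperm o i = tperm o (tperm r m i) * tperm r m.
Proof.
move=> /eqP om /eqP ir; apply/permP=> z; rewrite !permM.
rewrite !permE /=.
by repeat match goal with |- context [?a == ?b] =>
  is_var a; is_var b; case: (a =P b) => ? /=; try subst; try congruence end.
Qed.

Section Lift.
Variables (T : finType) (o m : T) (A : {set T}) (C : {set {perm T}}).
Hypotheses (oA : o \in A) (mA : m \notin A).

Definition lift_code := [set x : {perm T} | x o != m & x * tperm m (x m) \in C].

(** Puts the bypass on the left, the side on which swaps act. *)
Lemma bypassE (x : {perm T}) : x * tperm m (x m) = tperm (x^-1 m) m * x.
Proof.
by rewrite -{1}(permKV x m) -tpermJ conjgE !mulgA mulgV mul1g.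
Qed.

(* [x * tperm m (x m)] is [x] with [m] deleted from its cycle. *)
Lemma bypass_perm_on x : perm_on (m |: A) x -> perm_on A (x * tperm m (x m)).
Proof.
move=> xA; apply/subsetP=> z; rewrite inE /= permM; apply: contraR => zA.
have [->|zm] := eqVneq z m; first by rewrite tpermR.
have xz : x z = z by apply: out_perm xA _; rewrite !inE negb_or zm.
rewrite xz tpermD // 1?eq_sym //.
by apply: contraNneq zm => xmz; apply/eqP/(@perm_inj _ x); rewrite xz.
Qed.

(** The bijection [tperm r m] matches the swaps of [x] with those of the bypassed [x]. The
    exceptional index [i = r] sends [o] to [m], so the lift rejects it, and its match [m] lies
    outside [A]. *)
Lemma lift_tiling : star_tiling o A C -> star_tiling o (m |: A) lift_code.
Proof.
move=> tC x xA; have om : o != m by apply: contraNneq mA => <-.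
have := tC _ (bypass_perm_on xA); rewrite bypassE; set r := x^-1 m => cardC.
have xr : x r = m by rewrite permKV.
have rA : r != m -> r \in A.
  by have := perm_closed r xA; rewrite xr !inE eqxx => /esym/predU1P[->|//] /eqP.
rewrite -cardC -[RHS](card_imset _ (@perm_inj _ (tperm r m))).
congr #|pred_of_set _|; apply/setP=> i.
rewrite -[i in RHS](tpermK r m) mem_imset; last exact: perm_inj.
rewrite !inE bypassE invMg tpermV permM -/r mulgA permM tpermL.
have [->|ir] := eqVneq i r; first by rewrite xr eqxx tpermL (negPf mA) andbF.
rewrite tperm_mul_conj // mulgA.
have -> : x i != m by rewrite -xr (inj_eq perm_inj).
rewrite andTb; congr (_ && _).
have [im|im] := eqVneq i m; last by rewrite tpermD // eq_sym.
by rewrite im tpermR rA //= -im eq_sym.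
Qed.

Lemma lift_code_sub x : perm_on A x -> x \in C -> x \in lift_code.
Proof.
move=> xA xC; have xm : x m = m by apply: out_perm xA _.
rewrite inE xm tperm1 mulg1 xC andbT.
by apply: contraNneq mA => xo; rewrite -(perm_inj (etrans xo (esym xm))).
Qed.
End Lift.

Lemma tiling_extend (T : finType) (o : T) (A : {set T}) (C : {set {perm T}}) :
    o \in A -> star_tiling o A C ->
  exists2 D, star_tiling o setT D &
    forall x, perm_on A x -> x \in C -> x \in D.
Proof.
have [n] := ubnP #|~: A|; elim: n A C => // n IHn A C.
have [A0|/set0Pn[m]] := eqVneq (~: A) set0.
  by move=> _ _ tC; exists C => //; rewrite -setC0 -A0 setCK.
rewrite inE => mA ltAn oA tC.
have [|||D tD DP] := IHn (m |: A) (lift_code o m C).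
- by rewrite (cardsD1 m) inE mA setDE -setCU setUC in ltAn.
- by rewrite !inE oA orbT.
- exact: lift_tiling.
exists D => // x xA xC; apply: DP; last exact: (lift_code_sub oA mA xA xC).
exact: subset_trans xA (subsetUr _ _).
Qed.

(** * The tiling by PGL(2,5) on six points *)

(* The edge [ab] of K_6 on Z/5 + {oo}, with oo encoded as 5, has colour [a + b],
   and the edge from oo to [a] has colour [2a]; PGL(2,5) is the stabilizer of
   the resulting 1-factorization, whose factors are listed in [pgl25].
   The diagonal entries 5 are never used. *)
Definition K6_colour (a b : nat) : nat :=
  (nth 0 (nth [::] [:: [:: 5; 1; 2; 3; 4; 0];
                      [:: 1; 5; 3; 4; 0; 2];
                      [:: 2; 3; 5; 0; 1; 4];
                      [:: 3; 4; 0; 5; 2; 1];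
                      [:: 4; 0; 1; 2; 5; 3];
                      [:: 0; 2; 4; 1; 3; 5]] a) b)%N.

Definition pgl25 (w : seq nat) : bool :=
  all (fun m => let c e := K6_colour (nth 0%N w e.1) (nth 0%N w e.2) in
                constant (map c m))
    ([:: [:: (0, 5); (1, 4); (2, 3)];
        [:: (1, 5); (0, 2); (3, 4)];
        [:: (2, 5); (1, 3); (0, 4)];
        [:: (3, 5); (2, 4); (0, 1)];
        [:: (4, 5); (0, 3); (1, 2)]])%N.

Definition swap_head (w : seq nat) (k : nat) : seq nat :=
  mkseq (fun j => nth 0%N w (if j == 0%N then k else if j == k then 0%N else j)) 6.

(** A finite check over 720 words; [k = 0] is the trivial swap. *)
Lemma pgl25_tiling :
  all (fun w => count (fun k => pgl25 (swap_head w k)) (iota 0 6) == 1%N)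
    (permutations (iota 0 6)).
Proof. by vm_compute. Qed.

Definition word (T : finType) (s : seq T) (x : {perm T}) : seq nat :=
  [seq index (x a) s | a <- s].

(** The action outside [s] is left free: the tiling is tested only on permutations supported on
    [s]. *)
Definition pgl25_code (T : finType) (s : seq T) : {set {perm T}} :=
  [set x | pgl25 (word s x)].

Lemma word_tperm (T : finType) (o : T) (t : seq T) (x : {perm T}) (k : nat) :
    uniq (o :: t) -> size t = 5%N -> k < 6 ->
  word (o :: t) (tperm o (nth o (o :: t) k) * x) = swap_head (word (o :: t) x) k.
Proof.
set s := o :: t => s_uniq t5 k6; have s6 : size s = 6%N by rewrite /= t5.
have so : o = nth o s 0 by [].
apply: (@eq_from_nth _ 0%N); first by rewrite size_map size_mkseq.
rewrite size_map s6 => j j6.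
rewrite nth_mkseq // (nth_map o) ?s6 // (nth_map o); last by rewrite s6; do 2![case: ifP => // _].
rewrite permM {1}so; congr (index (x _) s).
have [->|j0] := eqVneq j 0%N; first by rewrite tpermL.
have [->|jk] := eqVneq j k; first by rewrite tpermR.
by rewrite tpermD // nth_uniq ?s6 // eq_sym.
Qed.

Lemma word_permutations (T : finType) (s : seq T) (x : {perm T}) :
  uniq s -> perm_on [set a in s] x -> word s x \in permutations (iota 0 (size s)).
Proof.
move=> s_uniq xs; rewrite mem_permutations.
have xsP a : a \in s -> x a \in s.
  by move=> sa; have := perm_closed a xs; rewrite !inE sa.
have w_uniq : uniq (word s x).
  rewrite map_inj_in_uniq // => a b /xsP sxa /xsP sxb /index_inj eq_ab.
  by apply: (@perm_inj _ x); apply: eq_ab.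
apply: uniq_perm; rewrite ?iota_uniq // => k.
have [||_ eq_mem] := uniq_min_size w_uniq (s2 := iota 0 (size s)); last exact: eq_mem.
- move=> _ /mapP[a /xsP sxa ->]; by rewrite mem_iota add0n index_mem.
- by rewrite size_map size_iota.
Qed.

Lemma pgl25_code_tiling (T : finType) (o : T) (t : seq T) :
    uniq (o :: t) -> size t = 5%N ->
  star_tiling o [set a in o :: t] (pgl25_code (o :: t)).
Proof.
set s := o :: t => s_uniq t5 x xs; have s6 : size s = 6%N by rewrite /= t5.
have := allP pgl25_tiling (word s x).
rewrite -{1}s6 word_permutations // => /(_ isT)/eqP <-.
set P := fun i => tperm o i * x \in pgl25_code s.
transitivity (count P s).
  rewrite -size_filter -(card_uniqP (filter_uniq _ s_uniq)).
  by apply: eq_card => i; rewrite mem_filter andbC /P !inE.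
rewrite -{1}(mkseq_nth o s) count_map s6; apply: eq_in_count => k.
by rewrite mem_iota /= => k6; rewrite /P inE word_tperm.
Qed.

(** * From tilings to perfect codes in the Star graph *)

Lemma star_graphP n (x y : 'S_n.+1) :
  reflect (exists2 i, i != ord0 & x = tperm ord0 i * y) (star_graph n.+1 x y).
Proof.
apply: (iffP exists_inP) => [[h]|[i i0 ->]].
  by rewrite star_setE => /imsetP[i]; rewrite !inE => i0 -> /eqP ->; exists i.
by exists (tperm ord0 i); rewrite // star_setE imset_f // !inE.
Qed.

Lemma star_regular n : regular_graph (star_graph n.+1) n.
Proof.
move=> x; have inj : injective (fun i : 'I_n.+1 => tperm ord0 i * x).
  by move=> i j /mulIg/permP/(_ ord0); rewrite !tpermL.
transitivity #|[set~ (ord0 : 'I_n.+1)]|; last by rewrite cardsC1 card_ord.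
rewrite -(card_imset _ inj).
congr #|pred_of_set _|; apply/setP=> y; rewrite inE.
apply/star_graphP/imsetP=> [][i i0 ->]; exists i; rewrite ?inE // in i0 *;
  by rewrite mulgA tperm2 mul1g.
Qed.

Section StarCode.
Variables (n : nat) (C : {set 'S_n.+1}).
Hypothesis tC : star_tiling ord0 [set: 'I_n.+1] C.

Lemma star_tiling_inj x i j :
  tperm ord0 i * x \in C -> tperm ord0 j * x \in C -> i = j.
Proof.
move=> iC jC; have /eqP/cards1P[k kP] : #|[set i in setT | tperm ord0 i * x \in C]| = 1%N.
  by apply: tC; apply/subsetP=> z; rewrite inE.
have /set1P -> : i \in [set k] by rewrite -kP !inE.
by apply/esym/set1P; rewrite -kP !inE.
Qed.

(** Double counting of the pairs [(x, i)] with [tperm ord0 i * x] in [C]: each [i] occurs with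
    [#|C|] permutations, each [x] with one index. *)
Lemma card_star_tiling : (#|C| * n.+1)%N = #|'S_n.+1|.
Proof.
transitivity (\sum_(x : 'S_n.+1) \sum_(i : 'I_n.+1) ((tperm ord0 i * x)%g \in C))%N.
  rewrite exchange_big /= (eq_bigr (fun=> #|C|)) => [|i _].
    by rewrite sum_nat_const card_ord mulnC.
  rewrite -(card_lcoset C (tperm ord0 i)) -sum1_card [RHS]big_mkcond /=.
  by apply: eq_bigr => x _; rewrite mem_lcoset tpermV; case: ifP.
rewrite -sum1_card; apply: eq_bigr => x _.
rewrite -(tC (x := x)); last by apply/subsetP=> z; rewrite inE.
by rewrite -sum1_card [RHS]big_mkcond; apply: eq_bigr => i _; rewrite !inE /=; case: (_ \in _).
Qed.

(** On a shorter path, some vertex would be brought into [C] by two different swaps: an end of a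
    path of length 1, one of the swaps being trivial, or the middle of a path of length 2. *)
Lemma star_tiling_path x p : x \in C -> last x p \in C -> last x p != x ->
  path (star_graph n.+1) x p -> 3 <= size p.
Proof.
move=> xC; case: p => [|a [|b [|//]]] /=; first by rewrite eqxx.
  move=> aC ax /andP[/star_graphP[i i0 def_x] _].
  case/eqP: i0; apply: (@star_tiling_inj a); first by rewrite -def_x.
  by rewrite tperm1 mul1g.
move=> bC bx /and3P[/star_graphP[i _ def_x] /star_graphP[j _ def_a] _].
have def_b : b = tperm ord0 j * a by rewrite def_a mulgA tperm2 mul1g.
case/eqP: bx; rewrite def_b def_x; congr (tperm _ _ * _).
by apply: (@star_tiling_inj a); rewrite -?def_b -?def_x.
Qed.

Lemma star_tiling_perfect (i j k : 'I_n.+1) :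
    uniq [:: ord0; i; j; k] -> 1 \in C ->
    tperm ord0 i * tperm ord0 j * tperm ord0 k \in C ->
  perfect_code (star_graph n.+1) C.
Proof.
rewrite /= !inE !negb_or => /and4P[/and3P[i0 j0 k0] /andP[ij ik] jk _] C1 Cc.
set c := _ * _ in Cc.
have c_neq1 : c != 1.
  apply/eqP=> /permP/(_ ord0); rewrite perm1 !permM tpermL !tpermD // 1?eq_sym //.
  by move=> i_o; rewrite i_o eqxx in i0.
exists n; split; [exact: star_regular | split | exact: card_star_tiling].
  exists c, 1; split=> //; split.
    exists [:: tperm ord0 j * tperm ord0 k; tperm ord0 k; 1]; split=> //=.
    rewrite andbT; apply/and3P; split; apply/star_graphP.
    - by exists i; rewrite 1?eq_sym // mulgA.
    - by exists j; rewrite 1?eq_sym.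
    - by exists k; rewrite 1?eq_sym // mulg1.
  move=> p cp p1; apply: (star_tiling_path Cc) cp; rewrite p1 //.
  by rewrite eq_sym.
move=> x y d xC yC xy [[p [xp py <-]] _].
by apply: (star_tiling_path xC) xp; rewrite py // eq_sym.
Qed.
End StarCode.

(** * Paths of length 3 between codewords as an isomorphism invariant *)

Definition detour_property (T : finType) (e : rel T) (C : {set T}) : Prop :=
  forall x a b y, x \in C -> y \in C -> e x a -> e a b -> e b y ->
  exists a' b', [/\ a' != a, e x a', e a' b' & e b' y].

Lemma detour_isomorphic (T : finType) (e : rel T) (C D : {set T}) :
  isomorphic_codes e C D -> detour_property e D -> detour_property e C.
Proof.
case=> f ef <- D_detour x a b y xC yC xa ab bx.
have [|||a' [b' [a'a xa' ab' by']]] :=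
  D_detour (f x) (f a) (f b) (f y) (imset_f f xC) (imset_f f yC); rewrite ?ef //.
exists (f^-1 a'), (f^-1 b').
split; first by rewrite -(inj_eq (@perm_inj _ f)) permKV.
all: by rewrite -ef !permKV.
Qed.

Lemma stab1_detour n : detour_property (star_graph n.+1) (stab1 n.+1).
Proof.
move=> x a b y; rewrite stab1E => /astab1P x0 /astab1P y0.
rewrite /= /aperm in x0 y0; move=> /star_graphP[i i0 def_x] /star_graphP[j j0 def_a] /star_graphP[k k0 def_b].
(* Since [x] and [y] fix [ord0], the path is [i, j, i], and the braid relation
   between [tperm ord0 i] and [tperm ord0 j] gives the path [j, i, j]. *)
have kji : tperm ord0 k (tperm ord0 j i) = ord0.
  apply: (@perm_inj _ y); rewrite y0 -[RHS]x0 def_x def_a def_b !permM.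
  by rewrite tpermL.
have ij : i != j.
  by apply: contraNneq k0 => ij; rewrite -kji ij tpermR tpermL.
rewrite [tperm _ j i]tpermD 1?eq_sym // in kji.
have ik : i = k by rewrite -(tpermK ord0 k i) kji tpermL.
subst k; exists (tperm ord0 i * (tperm ord0 j * y)), (tperm ord0 j * y).
(* Both sides of the braid relation equal [tperm i j]. *)
have conjE (u v : 'I_n.+1) : v != ord0 -> u != v ->
    tperm ord0 u * tperm ord0 v * tperm ord0 u = tperm u v.
  move=> v0 uv; rewrite -{1}[tperm ord0 u]tpermV -mulgA -conjgE tpermJ tpermL.
  by rewrite tpermD // eq_sym.
split.
- rewrite def_a def_b !mulgA (inj_eq (mulIg y)).
  apply/eqP=> /permP/(_ ord0); rewrite !permM !tpermL !tpermD // 1?eq_sym //.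
  by move/eqP; rewrite (negPf ij).
- apply/star_graphP; exists j => //; rewrite def_x def_a def_b !mulgA.
  by rewrite (conjE i j) // (conjE j i) // 1?eq_sym // tpermC.
- by apply/star_graphP; exists i.
- by apply/star_graphP; exists j.
Qed.

(** The 4-cycle sends [ord0] to [i]. Swaps [i'], [j'], [k'] in this order send [ord0] to [i'],
    unless [j' = i'], when only one swap remains, or [k' = i'], when [ord0] is fixed. Hence
    [i' = i], which forces the first inner vertex. *)
Lemma four_cycle_no_detour n (C : {set 'S_n.+1}) (i j k : 'I_n.+1) :
    uniq [:: ord0; i; j; k] -> 1 \in C ->
    tperm ord0 i * tperm ord0 j * tperm ord0 k \in C ->
  ~ detour_property (star_graph n.+1) C.
Proof.
rewrite /= !inE !negb_or => /and4P[/and3P[i0 j0 k0] /andP[ij ik] jk _] C1 Cc.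
rewrite eq_sym in i0; rewrite eq_sym in j0; rewrite eq_sym in k0.
move=> /(_ _ (tperm ord0 j * tperm ord0 k) (tperm ord0 k) 1 Cc C1).
case=> [|||a [b [/eqP]]]; try apply/star_graphP.
- by exists i; rewrite ?mulgA.
- by exists j.
- by exists k; rewrite ?mulg1.
move=> neq_a /star_graphP[i' i'0 def_c] /star_graphP[j' j'0 def_a] /star_graphP[k' k'0].
rewrite mulg1 => def_b; subst a b.
have [ii'|ii'] := eqVneq i i'.
  by apply: neq_a; apply: (mulgI (tperm ord0 i)); rewrite [RHS]mulgA def_c ii'.
have := congr1 (fun s : 'S_n.+1 => s ord0) def_c.
rewrite !permM !tpermL [tperm _ j i]tpermD 1?eq_sym // [tperm _ k i]tpermD 1?eq_sym //.
have [ij'|ij'] := eqVneq i' j'.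
  rewrite ij' tpermR tpermL => ik'; rewrite ij' mulgA tperm2 mul1g -ik' in def_c.
  have /permP/(_ ord0) : tperm ord0 j * tperm ord0 k = 1.
    by apply: (mulgI (tperm ord0 i)); rewrite mulgA def_c mulg1.
  by rewrite permM tpermL tpermD 1?eq_sym // perm1 => /eqP; rewrite (negPf j0).
rewrite [tperm _ j' i']tpermD 1?eq_sym //.
have [->|ik'] := eqVneq i' k'; first by rewrite tpermR => /eqP; rewrite (negPf i0).
by rewrite tpermD 1?eq_sym // => /eqP; rewrite (negPf ii').
Qed.

Lemma word1 (T : finType) (s : seq T) : uniq s -> word s 1 = iota 0 (size s).
Proof.
case: s => [|o t] // s_uniq; rewrite /word; set s := o :: t in s_uniq *.
apply: (@eq_from_nth _ 0%N) => [|i]; rewrite size_map ?size_iota // => i_s.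
by rewrite (nth_map o) // nth_iota // perm1 index_uniq.
Qed.

Theorem corollary3 (n : nat) (n_ge6 : 6 <= n) :
  exists C : {set 'S_n},
    perfect_code (star_graph n) C /\
    ~ isomorphic_codes (star_graph n) C (stab1 n).
Proof.
case: n n_ge6 => // n n_ge6.
pose t := take 5 (enum [set~ (ord0 : 'I_n.+1)]); pose s := ord0 :: t.
have t5 : size t = 5%N by rewrite size_takel // -cardE cardsC1 card_ord.
have s6 : size s = 6%N by rewrite /= t5.
have s_uniq : uniq s.
  rewrite /= take_uniq ?enum_uniq // andbT.
  by apply/negP=> /mem_take; rewrite mem_enum !inE eqxx.
have [|D tD sub_D] := tiling_extend _ (pgl25_code_tiling s_uniq t5).
  by rewrite !inE eqxx.
pose p m := nth ord0 s m.
have p_on m : m < 6 -> perm_on [set a in s] (tperm ord0 (p m)).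
  move=> m6; apply: subset_trans (tperm_on _ _) _.
  have: p m \in s by rewrite mem_nth // s6.
  by rewrite subUset !sub1set !inE eqxx.
have D1 : 1 \in D.
  by apply: sub_D; [apply: perm_on1 | rewrite inE word1 // s6].
(* This is the affine map z -> 2z + 1 of Z/5, the 4-cycle (0 1 3 2) fixing 4 and oo. *)
have Dc : tperm ord0 (p 1%N) * tperm ord0 (p 3) * tperm ord0 (p 2) \in D.
  apply: sub_D; first by do 2?apply: perm_onM; apply: p_on.
  by rewrite -[_ * tperm _ (p 2)]mulg1 -!mulgA inE !word_tperm // word1 // s6.
have p_uniq : uniq [:: ord0; p 1%N; p 3; p 2].
  rewrite -[[:: _; _; _; _]]/(map p [:: 0; 1; 3; 2]%N) map_inj_in_uniq //.
  have lt6 a : a \in [:: 0; 1; 3; 2]%N -> a < 6.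
    by rewrite !inE => /or4P[] /eqP ->.
  by move=> a b /lt6 a6 /lt6 b6 /eqP; rewrite nth_uniq ?s6 // => /eqP.
exists D; split; first exact: (star_tiling_perfect tD p_uniq D1 Dc).
by move/detour_isomorphic/(_ (@stab1_detour n)); apply: four_cycle_no_detour Dc.
Qed.
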